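(* Let $n\ge 1$ and let $G=\operatorname{SL}_2(\mathbb{C})\times\operatorname{SL}_2(\mathbb{C})$ act on the space $\mathcal{M}_{2,2}^n$ of $n$-tuples of $2\times 2$ complex matrices by $(g,h)\cdot(A_1,\ldots,A_n)=(gA_1h^{-1},\ldots,gA_nh^{-1})$. If $S\subseteq\mathbb{C}[\mathcal{M}_{2,2}^n]^G$ is a separating set, then $|S|\ge 5n-9$.
   Context: Write $\mathcal{V}=\mathcal{M}_{2,2}^n$. The group $G$ acts on polynomial functions $f\in\mathbb{C}[\mathcal{V}]$ by $(g\cdot f)(v)=f(g^{-1}\cdot v)$, and $\mathbb{C}[\mathcal{V}]^G$ is the algebra of invariant polynomial functions. A subset $S\subseteq\mathbb{C}[\mathcal{V}]^G$ is a separating set if for all $v,w\in\mathcal{V}$: $s(v)=s(w)$ for all $s\in S$ if and only if $f(v)=f(w)$ for all $f\in\mathbb{C}[\mathcal{V}]^G$. *)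

(* Defs.v *)
From mathcomp Require Import all_boot all_order all_algebra.
From mathcomp Require Import complex.
From mathcomp Require Import mpoly.
From mathcomp Require Import boolp classical_sets functions cardinality reals.

Set Implicit Arguments.
Unset Strict Implicit.
Unset Printing Implicit Defensive.

Import Order.TTheory GRing.Theory Num.Theory.

Local Open Scope classical_set_scope.
Local Open Scope ring_scope.

(* [R[i]], for [R : realType], is the field of complex numbers. *)

Definition Mat22n (R : realType) (n : nat) : Type := {ffun 'I_n -> 'M[R[i]]_2}.

Definition SL2 (R : realType) : set 'M[R[i]]_2 := [set g | \det g = 1].

Definition SL2xSL2 (R : realType) : set ('M[R[i]]_2 * 'M[R[i]]_2) :=
  @SL2 R `*` @SL2 R.

Definition act (R : realType) (n : nat) (gh : 'M[R[i]]_2 * 'M[R[i]]_2)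
    (v : Mat22n R n) : Mat22n R n :=
  [ffun k => gh.1 *m v k *m invmx gh.2].

Definition act_fun (R : realType) (n : nat) (gh : 'M[R[i]]_2 * 'M[R[i]]_2)
    (f : Mat22n R n -> R[i]) : Mat22n R n -> R[i] :=
  fun v => f (act (invmx gh.1, invmx gh.2) v).

(* The 4n coordinates are indexed by the triples (k, (a, b)) -- matrix, row,
   column -- through the canonical enumeration of that finite type. *)
Definition coords (R : realType) (n : nat) (v : Mat22n R n)
    (j : 'I_#|{: 'I_n * ('I_2 * 'I_2)}|) : R[i] :=
  let t := enum_val j in v t.1 t.2.1 t.2.2.

Definition polynomial_functions (R : realType) (n : nat) :
    set (Mat22n R n -> R[i]) :=
  [set f | exists p : {mpoly R[i][#|{: 'I_n * ('I_2 * 'I_2)}|]},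
             forall v, f v = p.@[coords v]].

Definition invariants (R : realType) (n : nat) : set (Mat22n R n -> R[i]) :=
  [set f | polynomial_functions f /\
           forall gh, SL2xSL2 gh -> act_fun gh f = f].

Definition separating (R : realType) (n : nat)
    (S : set (Mat22n R n -> R[i])) : Prop :=
  S `<=` @invariants R n /\
  forall v w : Mat22n R n,
    (forall s, S s -> s v = s w) <-> (forall f, invariants f -> f v = f w).

(* Main.v *)
Require Import Defs.
From mathcomp Require Import all_boot all_order all_algebra.
From mathcomp Require Import complex.
From mathcomp Require Import mpoly.
From mathcomp Require Import boolp classical_sets functions cardinality reals.
From mathcomp Require Import ring.

(* Choose a slice of the base points v and a 4n-dimensional family of
   displacements w - v such that v and w have the same invariants exactly on the
   union of two coordinate subspaces meeting only at the origin (after freezing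
   eight coordinates): on one of them v = w, on the other v and w are upper
   triangular with equal diagonals, and degenerate to the same closed orbit under
   a torus. Thus r separating invariants cut out, together with eight linear forms,
   this union in affine 5n-space, and it remains to see that two such subspaces in
   N-space are not cut out by fewer than N - 1 equations, a special case of the
   connectedness theorems of Hartshorne and Grothendieck. This is Mayer-Vietoris for
   local cohomology: H^N supported at the origin is nonzero, containing the class
   of 1/(x_1 ... x_N), whereas the Cech complex of N - 2 elements has no H^(N-1),
   and H^N supported in either subspace vanishes because that subspace is positive
   dimensional. The Nullstellensatz makes the Cech complex of the equations
   depend only on their zero set. For n = 3 one of the subspaces is trivial and
   the same argument gives the codimension bound of Krull. *)

Set Implicit Arguments.
Unset Strict Implicit.
Unset Printing Implicit Defensive.

Import Order.TTheory GRing.Theory Num.Theory.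

Local Open Scope classical_set_scope.
Local Open Scope ring_scope.

(** * Nullstellensatz over an uncountable field *)

Section Nullstellensatz.
Variables (K : closedFieldType) (n : nat).
Local Notation A := {mpoly K[n]}.

Definition is_ideal (I : set A) : Prop :=
  [/\ I 0, forall p q, I p -> I q -> I (p + q) & forall a p, I p -> I (a * p)].

Lemma idealB (I : set A) p q : is_ideal I -> I p -> I q -> I (p - q).
Proof. by case=> _ ID IM Ip Iq; rewrite -mulN1r; apply: ID => //; apply: IM. Qed.

Lemma ideal_sum (I : set A) (J : Type) (r : seq J) (P : pred J) (F : J -> A) :
  is_ideal I -> (forall j, P j -> I (F j)) -> I (\sum_(j <- r | P j) F j).
Proof. by case=> I0 ID _ IF; apply: big_ind. Qed.

(** Zorn's lemma for the ideals that contain [I] and no power of [h]. The last clause is maximality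
    tested on the ideal generated by [M] and [p]; it makes the localization of A/M at [h] a
    field. *)
Lemma maximal_avoiding_ideal (I : set A) (h : A) :
    is_ideal I -> (forall D, ~ I (h ^+ D)) ->
  exists M : set A, [/\ is_ideal M, I `<=` M, forall D, ~ M (h ^+ D)
    & forall p, ~ M p -> exists u D, M (p * u - h ^+ D)].
Proof.
move=> idI Ih.
pose good (M : set A) := [/\ is_ideal M, I `<=` M & forall D, ~ M (h ^+ D)].
have [|M [gM maxM]] := @Zorn_bigcup A [set M | M = set0 \/ good M].
  move=> F FP Ftot; have [[M0 FM0 gM0]|nogood] := pselect (exists2 M, F M & good M).
    right; have [[M00 _ _] IM0 _] := gM0.
    have Fgood M p : F M -> M p -> good M.
      by move=> /FP[-> //|]; case.
    split.
    - split; first by exists M0.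
      + move=> p q [M1 FM1 M1p] [M2 FM2 M2q].
        have [[_ M1D _] _ _] := Fgood _ _ FM1 M1p.
        have [[_ M2D _] _ _] := Fgood _ _ FM2 M2q.
        case: (Ftot _ _ FM1 FM2) => [M12|M21].
          by exists M2 => //; apply: M2D => //; apply: M12.
        by exists M1 => //; apply: M1D => //; apply: M21.
      + move=> a p [M1 FM1 M1p]; exists M1 => //.
        by have [[_ _ M1M] _ _] := Fgood _ _ FM1 M1p; apply: M1M.
    - by move=> p Ip; exists M0 => //; apply: IM0.
    - move=> D [M1 FM1 M1h].
      by have [_ _ /(_ D)] := Fgood _ _ FM1 M1h; apply.
  left; apply/seteqP; split => // p [M FM Mp]; case: (FP _ FM) Mp => [-> //|gM _].
  by apply: nogood; exists M.
have {}gM : good M.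
  case: gM => // M0; have [I0 _ _] := idI.
  case: (maxM I); last by right; split.
  by rewrite M0; split=> // /(_ 0 I0).
have [idM IM Mh] := gM; have [M0 MD MM] := idM.
exists M; split=> // p Mp.
pose N := [set a | exists q u, M q /\ a = q + p * u].
have idN : is_ideal N.
  split.
  - by exists 0, 0; rewrite mulr0 addr0.
  - move=> _ _ [q1 [u1 [Mq1 ->]]] [q2 [u2 [Mq2 ->]]].
    by exists (q1 + q2), (u1 + u2); split; [apply: MD | rewrite mulrDr addrACA].
  - move=> a _ [q [u [Mq ->]]]; exists (a * q), (a * u).
    by split; [apply: MM | rewrite mulrDr mulrCA].
have MN : M `<=` N by move=> q Mq; exists q, 0; rewrite mulr0 addr0.
have Np : N p by exists 0, 1; rewrite mulr1 add0r.
have : ~ (M = set0 \/ good N) -> exists D, N (h ^+ D).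
  move=> /not_orP[_ gN]; apply: contrapT => /forallNP Nh; apply: gN.
  by split=> //; apply: subset_trans MN.
case.
  case=> [M00|gN]; first by move: M0; rewrite M00.
  by apply: (maxM N); [split=> // /(_ _ Np) | right].
move=> D [q [u [Mq hD]]]; exists u, D.
by rewrite hD opprD addrCA subrr addr0 -mulN1r; apply: MM.
Qed.

(** If neither factor were in [M], each would divide a power of [h] modulo [M]; then so would
    [p * q], and a power of [h] would lie in [M]. *)
Lemma maximal_avoiding_prime (M : set A) (h : A) :
    is_ideal M -> (forall D, ~ M (h ^+ D)) ->
    (forall p, ~ M p -> exists u D, M (p * u - h ^+ D)) ->
  forall p q, M (p * q) -> M p \/ M q.
Proof.
move=> idM Mh maxM p q Mpq; have [_ MD MM] := idM.
apply: contrapT => /not_orP[/maxM[u [D Mu]] /maxM[v [E Mv]]].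
apply: (Mh (D + E)%N); rewrite exprD.
have -> : h ^+ D * h ^+ E = u * v * (p * q)
    - (q * v * (p * u - h ^+ D) + h ^+ D * (q * v - h ^+ E)) by ring.
by apply: idealB => //; [apply: MM | apply: MD; apply: MM].
Qed.

(** The coefficient matrix has more rows than there are monomials of degree below [s], so its left
    kernel is nonzero. *)
Lemma mpoly_linear_dependence (s k : nat) (u : 'I_k -> A) :
    (#|{: 'X_{1..n < s}}| < k)%N -> (forall j, (msize (u j) <= s)%N) ->
  exists2 c : 'rV[K]_k, c != 0 & \sum_j c 0 j *: u j = 0.
Proof.
move=> ks us; set b := #|_| in ks.
pose U := \matrix_(j < k, l < b) (u j)@_(enum_val l : 'X_{1..n < s}).
have : kermx U != 0.
  rewrite kermx_eq0 /row_free; apply: contraTneq ks => <-.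
  by rewrite -leqNgt rank_leq_col.
case/rowV0Pn => c /sub_kermxP cU c0; exists c => //.
apply/mpolyP => m; rewrite mcoeff0 raddf_sum /=.
have [ms|ms] := ltnP (mdeg m) s; last first.
  apply: big1 => j _; rewrite mcoeffZ memN_msupp_eq0 ?mulr0 //.
  by apply: msize_mdeg_ge; apply: leq_trans ms.
have /rowP/(_ (enum_rank (BMultinom ms))) := cU.
rewrite !mxE => cU0; rewrite -[RHS]cU0; apply: eq_bigr => j _.
by rewrite mcoeffZ !mxE enum_rankK.
Qed.

Hypothesis uncountK : ~ countable [set: K].

(* Amitsur's trick: otherwise the inverses of the [x_i - a] modulo [M] form an
   uncountable family in a space of countable dimension. *)
Lemma maximal_avoiding_coordinate (M : set A) (h : A) :
    is_ideal M -> (forall D, ~ M (h ^+ D)) ->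
    (forall p, ~ M p -> exists u D, M (p * u - h ^+ D)) ->
  forall x : A, exists a : K, M (x - a%:MP).
Proof.
move=> idM Mh maxM x; apply: contrapT => /forallNP Mx.
have Mprime := maximal_avoiding_prime idM Mh maxM.
have [M0 MD MM] := idM.
(* The scalars are sorted by the exponent of [h] and a size bound on the inverse [u]. These are
   countably many classes, so one of them is infinite. *)
pose C (Ds : nat * nat) := [set a : K | exists u : A,
  (msize u <= Ds.2)%N /\ M ((x - a%:MP) * u - h ^+ Ds.1)].
have [Ds Cinf] : exists Ds, infinite_set (C Ds).
  apply: contrapT => /forallNP Cfin; apply: uncountK.
  have <- : \bigcup_(Ds in setT) C Ds = setT.
    apply/seteqP; split=> // a _; have [u [D Mu]] := maxM _ (Mx a).
    by exists (D, msize u) => //; exists u.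
  apply: bigcup_countable => [|Ds _]; first exact: countableP.
  by apply: finite_set_countable; apply: contrapT; apply: Cfin.
case: Ds Cinf => D s Cinf; set b := #|{: 'X_{1..n < s}}|.
have [B BC Bsize] := infinite_set_fset b.+1 Cinf.
pose f (j : 'I_b.+1) := nth 0 (finmap.enum_fset B) j.
have jB (j : 'I_b.+1) : (j < size (finmap.enum_fset B))%N.
  exact: leq_trans (ltn_ord j) Bsize.
have fC j : C (D, s) (f j) by apply/BC/mem_nth/jB.
have finj : injective f.
  by move=> i j /eqP; rewrite nth_uniq ?jB ?finmap.fset_uniq // => /eqP/val_inj.
have {fC}/choice[u Cu] : forall j, exists u : A,
  (msize u <= s)%N /\ M ((x - (f j)%:MP) * u - h ^+ D) by move=> j; apply: fC.
have [c c0 csum] := @mpoly_linear_dependence s b.+1 u (ltnSn _)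
   (fun j => (Cu j).1).
have /rV0Pn[j0 cj0] := c0.
(* Up to a power of [h], [u j] inverts [x - f j] modulo [M]. [Q] is the numerator of the sum of the
   c_j / (X - f_j); at [f j0] only the term [j0] survives, so [Q] is nonzero. *)
pose Q : {poly K} := \sum_(j < b.+1) c 0 j *: \prod_(l < b.+1 | l != j) ('X - (f l)%:P).
have Q0 : Q != 0.
  apply: contra_neq cj0 => /(congr1 (horner^~ (f j0))).
  rewrite horner0 horner_sum (bigD1 j0) //= [X in _ + X]big1 => [|j jj0]; last first.
    by rewrite hornerZ horner_prod (bigD1 j0) 1?eq_sym //= hornerXsubC subrr mul0r mulr0.
  rewrite addr0 hornerZ horner_prod => /eqP; rewrite mulf_eq0 => /orP[/eqP->//|].
  case/prodf_eq0=> l lj0; rewrite hornerXsubC subr_eq0 => /eqP/finj lj.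
  by rewrite lj eqxx in lj0.
have xC : commr_rmorph (@mpolyC n K) x by move=> a; apply: mulrC.
pose ev : {rmorphism {poly K} -> A} := horner_morph xC.
have evC a : ev a%:P = a%:MP by rewrite /= horner_morphC.
have evXsubC a : ev ('X - a%:P) = x - a%:MP by rewrite rmorphB evC /= horner_morphX.
have : M (h ^+ D * ev Q).
  have -> : h ^+ D * ev Q = - \sum_(j < b.+1)
      (c 0 j)%:MP * (\prod_(l < b.+1 | l != j) (x - (f l)%:MP)) *
         ((x - (f j)%:MP) * u j - h ^+ D).
    rewrite rmorph_sum mulr_sumr.
    have -> : \sum_(j < b.+1) (c 0 j)%:MP * (\prod_(l < b.+1 | l != j) (x - (f l)%:MP)) *
         ((x - (f j)%:MP) * u j - h ^+ D) =
       \prod_(l < b.+1) (x - (f l)%:MP) * \sum_j (c 0 j *: u j)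
         - \sum_(j < b.+1) h ^+ D * ev (c 0 j *: \prod_(l < b.+1 | l != j) ('X - (f l)%:P)).
      rewrite mulr_sumr -sumrB; apply: eq_bigr => j _; rewrite mulrBr; congr (_ - _).
        rewrite [in RHS](bigD1 j) //= -mul_mpolyC.
        by move: (\prod_(l < _ | _) _) => y; ring.
      rewrite -mul_polyC rmorphM rmorph_prod mulrC; congr (_ * (_ * _)).
        by rewrite evC.
      by apply: eq_bigr => l _; rewrite evXsubC.
    by rewrite csum mulr0 sub0r opprK.
  rewrite -mulN1r; apply: (MM); apply: ideal_sum => // j _.
  by apply: MM; case: (Cu j).
case/Mprime => [/Mh //|].
(* As [Q] splits, primality puts into [M] a nonzero constant or some [x - a], both of which are
   excluded. *)
have [r Qr] := closed_field_poly_normal Q.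
rewrite Qr -mul_polyC rmorphM; case/Mprime.
  rewrite evC => Mc; apply: (Mh 0%N); rewrite expr0.
  have -> : 1 = (lead_coef Q)^-1%:MP * (lead_coef Q)%:MP :> A.
    by rewrite -mpolyCM mulVf ?lead_coef_eq0.
  exact: MM.
elim: r {Qr} => [|a r IHr]; first by rewrite big_nil rmorph1; apply: (Mh 0%N).
by rewrite big_cons rmorphM evXsubC => /Mprime[/Mx|/IHr].
Qed.

(** Otherwise a maximal ideal avoiding the powers of [h] is the kernel of evaluation at a point [v].
    This [v] is a common zero of [I], so [h] vanishes there and lies in the ideal. *)
Theorem nullstellensatz (I : set A) (h : A) : is_ideal I ->
    (forall v : 'I_n -> K, (forall p, I p -> p.@[v] = 0) -> h.@[v] = 0) ->
  exists D, I (h ^+ D).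
Proof.
move=> idI Ih; apply: contrapT => /forallNP/(maximal_avoiding_ideal idI).
case=> M [idM IM Mh maxM]; have [M0 MD MM] := idM.
have /choice[v Mv] i := maximal_avoiding_coordinate idM Mh maxM 'X_i.
have Mev p : M (p - p.@[v]%:MP).
  elim/mpolyind: p => [|c m p _ _ Mp]; first by rewrite meval0 subrr.
  rewrite mevalD mpolyCD opprD addrACA; apply: (MD) => //.
  rewrite mevalZ mpolyCM mul_mpolyC -scalerBr -mul_mpolyC; apply: (MM).
  rewrite mpolyXE_id rmorph_prod (rmorph_prod (@mpolyC n K)) /=.
  elim/big_rec2: _ => [|i y2 y1 _ My]; first by rewrite subrr.
  rewrite !rmorphXn /= mevalXU.
  have -> : 'X_i ^+ m i * y1 - (v i)%:MP ^+ m i * y2 =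
     'X_i ^+ m i * (y1 - y2) + y2 * ('X_i ^+ m i - (v i)%:MP ^+ m i).
    by ring.
  by apply: (MD); [apply: (MM) | apply: (MM); rewrite subrXX mulrC; apply: (MM)].
have Mnz p : M p -> p.@[v] = 0.
  move=> Mp; apply: contra_notP (Mh 0%N) => /eqP pv0; rewrite expr0.
  have -> : 1 = (p.@[v])^-1%:MP * (p - (p - p.@[v]%:MP)) :> A.
    by rewrite opprB addrC subrK -mpolyCM mulVf.
  by apply: MM; apply: idealB.
have := Mev h; rewrite Ih ?mpolyC0 ?subr0; last by move=> p /IM/Mnz.
by move=> Mhh; apply: (Mh 1%N); rewrite expr1.
Qed.

End Nullstellensatz.

(** * Cech complexes *)

Lemma mulfK_middle (F : fieldType) (a b c d e x : F) :
  x != 0 -> a * b / x * c * (d * x * e) = a * d * (c * (b * e)).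
Proof. by move=> ?; field. Qed.

Section Cech.
Variables (A : idomainType) (J : finType) (g : J -> A).
Hypothesis g_neq0 : forall j, g j != 0.
Local Notation Q := {fraction A}.
Local Notation "x %:F" := (@FracField.tofrac A x).
Local Notation cochain := {ffun {set J} -> Q}.
Implicit Types (c b : cochain) (s : {set J}).

Definition gprod s : A := \prod_(j in s) g j.

Lemma gprod_neq0 s : gprod s != 0.
Proof. by apply/prodf_neq0 => j _; apply: g_neq0. Qed.

Lemma gprodU1 j s : j \notin s -> gprod (j |: s) = g j * gprod s.
Proof. by move=> js; rewrite /gprod big_setU1. Qed.

Lemma gprodID s P : gprod s = gprod (s :&: P) * gprod (s :\: P).
Proof. by rewrite /gprod (big_setID P). Qed.

(* [loc x] is the localization [A[1/x]], viewed inside the fraction field. *)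
Definition loc (x : A) (q : Q) : Prop := exists D a, q * (x ^+ D)%:F = a%:F.

Lemma loc0 x : loc x 0.
Proof. by exists 0%N, 0; rewrite mul0r tofrac0. Qed.

Lemma locD x q1 q2 : loc x q1 -> loc x q2 -> loc x (q1 + q2).
Proof.
move=> [D1 [a1 e1]] [D2 [a2 e2]].
exists (D1 + D2)%N, (a1 * x ^+ D2 + a2 * x ^+ D1).
by rewrite tofracD !tofracM -e1 -e2 exprD tofracM; ring.
Qed.

Lemma loc_sum x (I : Type) (r : seq I) (P : pred I) (F : I -> Q) :
  (forall i, P i -> loc x (F i)) -> loc x (\sum_(i <- r | P i) F i).
Proof. by move=> PF; apply: big_ind => //; [apply: loc0 | apply: locD]. Qed.

Lemma loc_scale x (a : A) q : loc x q -> loc x (a%:F * q).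
Proof. by move=> [D [a1 e1]]; exists D, (a * a1); rewrite -mulrA e1 tofracM. Qed.

Lemma locN x q : loc x q -> loc x (- q).
Proof. by move=> /(loc_scale (-1)); rewrite tofracN tofrac1 mulN1r. Qed.

Lemma loc_mul x y q : loc x q -> loc (x * y) q.
Proof.
by move=> [D [a e]]; exists D, (a * y ^+ D); rewrite exprMn !tofracM -e mulrA.
Qed.

(** A cochain carries all degrees at once, with values in the fraction field. The valid ones form
    the Cech complex that includes a term A at the empty set, as local cohomology requires. *)
Definition valid c := forall s, loc (gprod s) (c s).

Lemma loc_bound c : valid c ->
  exists M, forall s, exists a, c s * (gprod s ^+ M)%:F = a%:F.
Proof.
move=> /choice[D cD]; exists (\max_s D s)%N => s; have [a e] := cD s.
exists (a * gprod s ^+ (\max_s D s - D s)).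
by rewrite tofracM -e -mulrA -tofracM -exprD subnKC // leq_bigmax.
Qed.

Lemma loc_subset s s' q : s \subset s' -> loc (gprod s) q -> loc (gprod s') q.
Proof. by move=> /finset.setIidPr ss' cs; rewrite (gprodID s' s) ss'; apply: loc_mul. Qed.

Definition before (i j : J) : bool := (enum_rank j < enum_rank i)%N.

Lemma before_anti i j : i != j -> before j i = ~~ before i j.
Proof.
move=> ij; rewrite /before -leqNgt ltn_neqAle andb_idl // => _.
by apply: contra ij => /eqP/val_inj/enum_rank_inj ->.
Qed.

Definition sgn (i : J) s : A := (-1) ^+ #|[set j in s | before i j]|.

Lemma sgn_sqr i s : sgn i s * sgn i s = 1.
Proof. by rewrite -expr2 sqrr_sign. Qed.

Lemma sgnD1 i s : sgn i (s :\ i) = sgn i s.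
Proof.
congr (_ ^+ _); apply: eq_card => j; rewrite !inE.
by case: eqVneq => // ->; rewrite /before ltnn !andbF.
Qed.

Lemma sgnU1 i s : sgn i (i |: s) = sgn i s.
Proof.
congr (_ ^+ _); apply: eq_card => j; rewrite !inE.
by case: eqVneq => // ->; rewrite /before ltnn !andbF.
Qed.

Lemma sgnD1_neq i j s : j \in s -> sgn i s = (-1) ^+ before i j * sgn i (s :\ j).
Proof.
move=> js; rewrite /sgn (cardsD1 j) inE js exprD; congr (_ * _ ^+ _).
by apply: eq_card => l; rewrite !inE andbA.
Qed.

Lemma sgn_swap i j s : i != j -> i \in s -> j \in s ->
  sgn i s * sgn j (s :\ i) = - (sgn j s * sgn i (s :\ j)).
Proof.
move=> ij si sj; rewrite (sgnD1_neq i sj) (sgnD1_neq j si) (before_anti ij).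
by case: (before i j); rewrite /= ?expr1 ?expr0; ring.
Qed.

Definition diff c : cochain :=
  [ffun s : {set J} => \sum_(i in s) (sgn i s)%:F * c (s :\ i)].

Lemma diffD c1 c2 : diff (c1 + c2) = diff c1 + diff c2.
Proof.
apply/ffunP => s; rewrite !ffunE -big_split /=.
by apply: eq_bigr => i _; rewrite ffunE mulrDr.
Qed.

Lemma diffN c : diff (- c) = - diff c.
Proof.
apply/ffunP => s; rewrite !ffunE -sumrN.
by apply: eq_bigr => i _; rewrite ffunE mulrN.
Qed.

Lemma diffB c1 c2 : diff (c1 - c2) = diff c1 - diff c2.
Proof. by rewrite diffD diffN. Qed.

Lemma eq_diff c1 c2 s :
  (forall s', s' \subset s -> c1 s' = c2 s') -> diff c1 s = diff c2 s.
Proof.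
move=> c12; rewrite !ffunE; apply: eq_bigr => i _; congr (_ * _).
by apply: c12; apply: subsetDl.
Qed.

Lemma diff_diff c : diff (diff c) = 0.
Proof.
apply/ffunP => s; rewrite !ffunE.
pose T i j := (sgn i s * sgn j (s :\ i))%:F * c (s :\ i :\ j).
have TC i j : i \in s -> j \in s -> i != j -> T i j = - T j i.
  move=> si sj ij; rewrite /T (sgn_swap ij si sj) tofracN mulNr.
  by congr (- (_ * c _)); apply/setP=> l; rewrite !inE andbCA.
(* Ordering the two removed indices splits the double sum into halves, which cancel since [T] is
   antisymmetric. *)
transitivity (\sum_(i in s) (\sum_(j in s | before i j) T i j
                           + \sum_(j in s | before j i) T i j)).
  apply: eq_bigr => i si; rewrite ffunE mulr_sumr (bigID (before i)) /=.
  congr (_ + _); apply: eq_big => [j|j _]; try by rewrite mulrA -tofracM.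
    rewrite !inE; case: eqVneq => [->|ji]; first by rewrite /before ltnn !andbF.
    by [].
  rewrite !inE; case: eqVneq => [->|ji]; first by rewrite /before ltnn andbF.
  by rewrite (before_anti ji) negbK.
rewrite big_split /=.
rewrite [X in _ + X](exchange_big_dep (mem s)) /=; last by move=> ? ? ? /andP[].
rewrite -big_split big1 //= => i si.
rewrite [X in _ + X](eq_bigl (fun j => (j \in s) && before i j)); last first.
  by move=> j; rewrite si.
rewrite -big_split big1 //= => j /andP[sj ij]; rewrite TC ?addNr //.
by apply: contraTneq ij => ->; rewrite /before ltnn.
Qed.


Lemma valid_add c1 c2 : valid c1 -> valid c2 -> valid (c1 + c2).
Proof. by move=> v1 v2 s; rewrite ffunE; apply: locD. Qed.

Lemma valid_opp c : valid c -> valid (- c).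
Proof. by move=> v s; rewrite ffunE; apply: locN. Qed.

Lemma valid_diff c : valid c -> valid (diff c).
Proof.
move=> v s; rewrite ffunE; apply: loc_sum => i si; apply: loc_scale.
by apply: loc_subset (v _); apply: subsetDl.
Qed.

Definition indeg p c := forall s, #|s| != p -> c s = 0.

Lemma indegB p c1 c2 : indeg p c1 -> indeg p c2 -> indeg p (c1 - c2).
Proof. by move=> h1 h2 s sp; rewrite !ffunE h1 ?h2 ?subr0. Qed.

Lemma indeg_diff p c : indeg p c -> indeg p.+1 (diff c).
Proof.
move=> h s sp; rewrite ffunE big1 // => i si; rewrite h ?mulr0 //.
by apply: contra sp => /eqP <-; rewrite (cardsD1 i s) si.
Qed.

(* [Dp], closed under subsets, selects a quotient of the Cech complex and [Bp],
   closed under supersets, a subcomplex of it, both made of whole columns: a column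
   consists of the [s] with the same part outside [P]. *)
Section Columns.
Variables (P : {set J}) (Dp Bp : pred {set J}).
Hypothesis Dp_down : forall r r' : {set J}, r' \subset r -> Dp r -> Dp r'.
Hypothesis Bp_up : forall r r' : {set J}, r' \subset r -> Bp r' -> Bp r.
(** Once [gprod r] is inverted, the powers [g i ^+ M] with [i] in [P] generate the unit ideal; this
    is what makes a column acyclic. *)
Hypothesis rad : forall r, Dp r -> Bp r -> forall M, exists D (a : J -> A),
  gprod r ^+ D = \sum_(i in P) a i * g i ^+ M.

Let col s := s :\: P.

Lemma col_sub s s' : s' \subset s -> col s' \subset col s.
Proof. exact: finset.setSD. Qed.

Lemma colD1_in i s : i \in P -> col (s :\ i) = col s.
Proof.
by move=> iP; apply/setP=> j; rewrite !inE; case: eqVneq => // ->; rewrite iP.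
Qed.

Lemma colU1_in i s : i \in P -> col (i |: s) = col s.
Proof.
by move=> iP; apply/setP=> j; rewrite !inE; case: eqVneq => // ->; rewrite iP.
Qed.

Lemma card_colD1 i s : i \in s -> i \notin P -> (#|col (s :\ i)| < #|col s|)%N.
Proof.
move=> si iP; apply: proper_card; apply/properP; split.
  by apply: col_sub; apply: subsetDl.
by exists i; rewrite !inE ?iP ?si ?eqxx.
Qed.

(** Modulo smaller columns, a column is the Cech complex of the [g i], [i] in [P], over a
    localization in which they generate the unit ideal, hence it is exact. *)
Lemma column_step c p k :
    valid c -> indeg p.+1 c ->
    (forall s, Dp (col s) -> diff c s = 0) ->
    (forall s, Dp (col s) -> ~~ Bp (col s) -> c s = 0) ->
    (forall s, Dp (col s) -> (#|col s| < k)%N -> c s = 0) ->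
  exists b, [/\ valid b, indeg p b, forall s, ~~ Bp (col s) -> b s = 0
    & forall s, Dp (col s) -> (#|col s| < k.+1)%N -> diff b s = c s].
Proof.
move=> vc hc dc cB ck; have [M cM] := loc_bound vc.
have /choice[Da Dae] (r : {set J}) : exists Da : nat * (J -> A), Dp r -> Bp r ->
    gprod r ^+ Da.1 = \sum_(i in P) Da.2 i * g i ^+ M.
  case: (boolP (Dp r && Bp r)) => [/andP[rD rB]|rDB].
    by have [D [a e]] := rad rD rB M; exists (D, a).
  by exists (0%N, fun=> 0) => rD rB; rewrite rD rB in rDB.
pose w r j : Q := ((Da r).2 j * g j ^+ M)%:F / (gprod r ^+ (Da r).1)%:F.
have w1 r : Dp r -> Bp r -> \sum_(j in P) w r j = 1.
  move=> rD rB; rewrite -mulr_suml -rmorph_sum -Dae // divff //.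
  by rewrite tofrac_eq0 expf_neq0 ?gprod_neq0.
pose active s := [&& Dp (col s), Bp (col s) & #|col s| == k].
pose b : cochain := [ffun s : {set J} => if active s then
  \sum_(j in P :\: s) w (col s) j * ((sgn j s)%:F * c (j |: s)) else 0].
(* As the [w r j] form a partition of unity with enough zeros to absorb the poles
   of [c], [b] is a contracting homotopy on each column of size [k]. *)
exists b; split.
- move=> s; rewrite ffunE; case: ifP => _; last exact: loc0.
  apply: loc_sum => j; rewrite inE => /andP[js jP].
  rewrite mulrCA; apply: loc_scale; have [a e] := cM (j |: s).
  exists ((Da (col s)).1 + M)%N.
  exists ((Da (col s)).2 j * gprod (s :&: P) ^+ (Da (col s)).1 * a).
  rewrite !tofracM -e gprodU1 // /w exprD !tofracM.
  have -> : gprod s ^+ (Da (col s)).1 =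
     gprod (s :&: P) ^+ (Da (col s)).1 * gprod (col s) ^+ (Da (col s)).1.
    by rewrite -exprMn -gprodID.
  rewrite exprMn !tofracM; apply: mulfK_middle.
  by rewrite tofrac_eq0 expf_neq0 ?gprod_neq0.
- move=> s sp; rewrite ffunE; case: ifP => // _; apply: big1 => j.
  by rewrite inE => /andP[js jP]; rewrite hc ?mulr0 // cardsU1 js add1n eqSS.
- by move=> s sB; rewrite ffunE /active (negPf sB) andbF.
move=> s sD; rewrite ltnS => sk.
have bout i : i \in s -> i \notin P -> b (s :\ i) = 0.
  move=> si iP; rewrite ffunE /active [_ == k]ltn_eqF ?andbF //.
  by apply: leq_trans sk; apply: card_colD1.
case: (boolP (Bp (col s))) => [sB|sB]; last first.
  rewrite cB // ffunE big1 // => i si; rewrite ffunE /active ifF ?mulr0 //.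
  apply: contraNF sB => /and3P[_ + _]; apply: Bp_up.
  by apply: col_sub; apply: subsetDl.
move: sk; rewrite leq_eqVlt => /orP[sk|sk]; last first.
  rewrite ck // ffunE big1 // => i si; rewrite ffunE /active [_ == k]ltn_eqF ?andbF ?mulr0 //.
  by apply: leq_ltn_trans sk; apply: subset_leq_card; apply: col_sub; apply: subsetDl.
pose E j := \sum_(i in s :&: P) (sgn i s * sgn j (s :\ i))%:F * c (j |: (s :\ i)).
have EP j : j \in P :\: s -> E j = c s.
  rewrite inE => /andP[js jP].
  (* In the cocycle condition at [j |: s], removing an index outside [P] leads to a smaller column,
     where [c] vanishes. *)
  have := dc (j |: s); rewrite colU1_in // => /(_ sD).
  rewrite ffunE (big_setU1 _ js) /= finset.setU1K // sgnU1.
  rewrite (big_setID P) /= [X in _ + (_ + X)]big1 ?addr0; last first.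
    move=> i; rewrite inE => /andP[iP si].
    have ij : i != j by apply: contraNneq iP => ->.
    have sij : (j |: s) :\ i = j |: (s :\ i).
      by apply/setP=> l; rewrite !inE; case: (eqVneq l j) => // ->; rewrite eq_sym ij.
    rewrite sij ck ?mulr0 // ?colU1_in //.
      by apply: Dp_down sD; apply: col_sub; apply: subsetDl.
    by rewrite -(eqP sk); apply: card_colD1.
  move=> /eqP; rewrite addr_eq0 => /eqP e.
  have -> : c s = (sgn j s)%:F * ((sgn j s)%:F * c s).
    by rewrite mulrA -tofracM sgn_sqr tofrac1 mul1r.
  rewrite e mulrN mulr_sumr -sumrN; apply: eq_bigr => i; rewrite inE => /andP[si iP].
  have ij : i != j by apply: contraNneq js => <-.
  have -> : (j |: s) :\ i = j |: (s :\ i).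
    by apply/setP=> l; rewrite !inE; case: (eqVneq l j) => // ->; rewrite eq_sym ij.
  rewrite mulrA -mulNr -tofracM -tofracN; congr (_%:F * _).
  rewrite (sgnD1_neq j si) (sgnD1_neq i (finset.setU11 j s)) finset.setU1K // (before_anti ij).
  by case: (before i j); rewrite /= ?expr1 ?expr0; ring.
rewrite ffunE (big_setID P) /= [X in _ + X]big1 ?addr0; last first.
  by move=> i; rewrite inE => /andP[iP si]; rewrite bout ?mulr0.
(* In [diff b s], adding back the removed [i] gives [w i * c s]; the other terms assemble into the
   [w j * E j], which equal [w j * c s]. The weights add up to 1. *)
transitivity (\sum_(i in s :&: P) w (col s) i * c s
     + \sum_(j in P :\: s) w (col s) j * E j).
  under [X in _ = _ + X]eq_bigr => j _ do rewrite mulr_sumr.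
  rewrite exchange_big -big_split; apply: eq_bigr => i; rewrite inE => /andP[si iP].
  rewrite ffunE /active colD1_in // sD sB sk /=.
  rewrite (_ : P :\: (s :\ i) = i |: (P :\: s)); last first.
    by apply/setP=> l; rewrite !inE; case: (eqVneq l i) => // ->; rewrite iP.
  rewrite big_setU1 /= ?inE ?si // finset.setD1K // mulrDr; congr (_ + _).
    rewrite mulrCA; congr (_ * _).
    by rewrite sgnD1 mulrA -tofracM sgn_sqr tofrac1 mul1r.
  by rewrite mulr_sumr; apply: eq_bigr => j _; rewrite tofracM; ring.
under [X in _ + X]eq_bigr => j jPs do rewrite EP //.
transitivity ((\sum_(j in P) w (col s) j) * c s); last by rewrite w1 // mul1r.
by rewrite [in RHS](big_setID s) /= finset.setIC mulrDl !mulr_suml.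
Qed.

(** Induction on the column size: the error [c - diff b] vanishes on columns smaller than [k], and
    [column_step] corrects it on those of size [k]. *)
Lemma column_acyclic c p :
    valid c -> indeg p.+1 c ->
    (forall s, Dp (col s) -> diff c s = 0) ->
    (forall s, Dp (col s) -> ~~ Bp (col s) -> c s = 0) ->
  exists b, [/\ valid b, indeg p b, forall s, ~~ Bp (col s) -> b s = 0
    & forall s, Dp (col s) -> diff b s = c s].
Proof.
move=> vc hc dc cB.
suff [b [vb hb bB bc]] : exists b, [/\ valid b, indeg p b,
    forall s, ~~ Bp (col s) -> b s = 0
    & forall s, Dp (col s) -> (#|col s| < #|J|.+1)%N -> diff b s = c s].
  by exists b; split=> // s sD; apply: bc => //; rewrite ltnS max_card.
elim: #|J|.+1 => [|k [b [vb hb bB bc]]].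
  exists 0; split=> // [s|s _|s _]; rewrite ?ffunE //; exact: loc0.
have [|||||b' [vb' hb' b'B b'c]] := @column_step (c - diff b) p k.
- by apply: valid_add => //; apply: valid_opp; apply: valid_diff.
- by apply: indegB => //; apply: indeg_diff.
- by move=> s sD; rewrite diffB diff_diff subr0; apply: dc.
- move=> s sD sB; rewrite !ffunE cB // big1 ?subr0 // => i si.
  rewrite bB ?mulr0 //; apply: contra sB; apply: Bp_up.
  by apply: col_sub; apply: subsetDl.
- by move=> s sD sk; rewrite ffunE [X in _ + X]ffunE bc ?subrr.
exists (b + b'); split.
- exact: valid_add.
- by move=> s sp; rewrite ffunE hb ?hb' ?addr0.
- by move=> s sB; rewrite ffunE bB ?b'B ?addr0.
- by move=> s sD sk; rewrite diffD ffunE b'c // !ffunE addrC subrK.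
Qed.

End Columns.
End Cech.

(** * Numbers of equations *)

Section ZeroSet.
Variables (K : closedFieldType) (N r : nat) (f : 'I_r -> {mpoly K[N]}).
Hypothesis uncountK : ~ countable [set: K].
Hypothesis f_neq0 : forall k, f k != 0.
Local Notation A := {mpoly K[N]}.
Local Notation Q := {fraction A}.
Local Notation "x %:F" := (@FracField.tofrac A x).
Local Notation J := ('I_r + 'I_N)%type.
Local Notation cochain := {ffun {set J} -> Q}.
Implicit Types (U X : {set 'I_N}) (s : {set J}) (b : cochain).

(** Equations and coordinates share one Cech complex, so that it can be cut into columns along
    either family. *)
Definition gen (j : J) : A := match j with inl k => f k | inr i => 'X_i end.

Lemma gen_neq0 j : gen j != 0.
Proof. by case: j => [k|i] /=; rewrite ?f_neq0 // -msize_poly_eq0 msizeX. Qed.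

Definition eqs : {set J} := [set j | if j is inl _ then true else false].
Definition vars U : {set J} := [set j | if j is inr i then i \in U else false].

Lemma eqsE : eqs = inl @: 'I_r.
Proof.
apply/setP=> -[k|i]; rewrite !inE; apply/esym; last by apply/imsetP=> -[].
by apply/imsetP; exists k.
Qed.

Lemma varsE U : vars U = inr @: U.
Proof.
apply/setP=> -[k|i]; rewrite !inE; apply/esym; first by apply/imsetP=> -[].
by rewrite mem_imset // => ? ? [].
Qed.

Lemma card_eqs : #|eqs| = r.
Proof. by rewrite eqsE card_imset ?card_ord // => ? ? []. Qed.

Lemma card_sub_eqs s : (forall i, inr i \notin s) -> (#|s| <= r)%N.
Proof.
move=> sr; apply: (@leq_trans #|eqs|); last by rewrite card_eqs.
apply: subset_leq_card; apply/fintype.subsetP => -[k|i]; rewrite inE //.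
by rewrite (negPf (sr i)).
Qed.

Lemma card_vars U : #|vars U| = #|U|.
Proof. by rewrite varsE card_imset // => ? ? []. Qed.

Lemma gprod_vars U : gprod gen (vars U) = \prod_(i in U) 'X_i.
Proof. by rewrite /gprod varsE big_imset //= => ? ? _ _ []. Qed.

Lemma gprod_eval s j v : j \in s -> (gen j).@[v] = 0 -> (gprod gen s).@[v] = 0.
Proof.
by move=> js gj; rewrite /gprod (bigD1 j js) /= mevalM gj mul0r.
Qed.

(** The Nullstellensatz turns an inclusion of zero sets into the hypothesis [rad]; passing to [M]-th
    powers does not change the zeros. *)
Lemma gen_rad (P s : {set J}) :
    (forall v, (forall j, j \in P -> (gen j).@[v] = 0) ->
       exists2 j, j \in s & (gen j).@[v] = 0) ->
  forall M, exists D (a : J -> A),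
    gprod gen s ^+ D = \sum_(j in P) a j * gen j ^+ M.
Proof.
move=> Ps M.
pose I : set A := [set p | exists a : J -> A, p = \sum_(j in P) a j * gen j ^+ M].
have idI : is_ideal I.
  split.
  - by exists (fun=> 0); rewrite big1 // => j _; rewrite mul0r.
  - move=> _ _ [a ->] [b ->]; exists (fun j => a j + b j).
    by rewrite -big_split; apply: eq_bigr => j _; rewrite mulrDl.
  - move=> c _ [a ->]; exists (fun j => c * a j).
    by rewrite mulr_sumr; apply: eq_bigr => j _; rewrite mulrA.
have [|D [a e]] := nullstellensatz uncountK idI (h := gprod gen s).
  move=> v Iv; have [j jP|j js gj] := Ps v; last exact: gprod_eval gj.
  apply/eqP; suff : (gen j).@[v] ^+ M == 0 by rewrite expf_eq0 => /andP[].
  rewrite -rmorphXn; apply/eqP/Iv; exists (fun l => (l == j)%:R).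
  rewrite (bigD1 j) //= eqxx mul1r big1 ?addr0 // => l /andP[_ /negPf->].
  by rewrite mul0r.
by exists D, a.
Qed.

(** Clearing denominators would put the product of the X_i^M, [i] in [U], into the ideal of the
    X_i^(M+1); comparing coefficients of that monomial excludes it. *)
Lemma inv_prod_vars_not_sum U (q : 'I_N -> Q) :
    (forall i, i \in U -> loc (\prod_(j in U :\ i) 'X_j : A) (q i)) ->
  \sum_(i in U) q i != (\prod_(i in U) 'X_i : A)%:F^-1.
Proof.
move=> qU; set x := \prod_(i in U) 'X_i.
have x0 : x%:F != 0.
  rewrite tofrac_eq0; apply/prodf_neq0 => i _.
  by rewrite -msize_poly_eq0 msizeX.
have /choice[Da qDa] i : exists Da : nat * A, i \in U ->
    q i * ((\prod_(j in U :\ i) 'X_j : A) ^+ Da.1)%:F = Da.2%:F.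
  by case: (boolP (i \in U)) => [/qU[D [a e]]|]; [exists (D, a) | exists (0%N, 0)].
pose M := (\max_i (Da i).1)%N.
apply/eqP => qx.
have : x ^+ M = \sum_(i in U)
    (Da i).2 * (\prod_(j in U :\ i) 'X_j) ^+ (M.+1 - (Da i).1) * 'X_[U_(i) *+ M.+1].
  apply/eqP; rewrite -tofrac_eq.
  have -> : (x ^+ M)%:F = x%:F^-1 * (x ^+ M.+1)%:F.
    by rewrite exprS tofracM mulrA mulVf // mul1r.
  rewrite -qx mulr_suml rmorph_sum /=; apply/eqP/eq_bigr => i iU.
  rewrite !tofracM -qDa // -!mulrA; congr (_ * _); rewrite -!tofracM; congr (_%:F).
  rewrite /x (big_setD1 i) //= exprMn -mpolyXn mulrA -exprD subnKC 1?mulrC //.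
  by apply: leqW; apply: leq_bigmax.
pose m0 := (\sum_(i in U) U_(i) *+ M)%MM.
move/(congr1 (mcoeff m0)).
have -> : x ^+ M = 'X_[m0].
  by rewrite /x -prodrXl -mprodXE; apply: eq_bigr => i _; rewrite mpolyXn.
rewrite mcoeffX eqxx raddf_sum big1 => [/eqP|i iU /=]; first by rewrite oner_eq0.
apply/eqP; rewrite mcoeff_eq0 (perm_mem (msuppMX _ _)); apply/mapP => -[m _ em].
have /mnmP/(_ i) := em; rewrite mnmDE mulmnE mnm1E eqxx mul1n.
rewrite mnm_sumE (bigD1 i) //= mulmnE mnm1E eqxx mul1n big1 ?addn0 => [MM|j /andP[_ ji]].
  by have := leq_addr (m i) M.+1; rewrite -MM ltnn.
by rewrite mulmnE mnm1E (negPf ji).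
Qed.

Lemma diff_vars_neq_inv b U : valid gen b ->
  diff b (vars U) != (\prod_(i in U) 'X_i : A)%:F^-1.
Proof.
move=> vb; rewrite ffunE (eq_bigl (mem (inr @: U))) => [|j]; last by rewrite varsE.
rewrite big_imset /=; last by move=> ? ? _ _ [].
apply: inv_prod_vars_not_sum => i iU; apply: loc_scale.
rewrite -gprod_vars (_ : vars (U :\ i) = vars U :\ inr i) //.
by apply/setP => -[k|j]; rewrite !inE.
Qed.

(** The class of the inverse product is spread over the combined complex. The equations vanish where
    the variables of [U] do, so columns along [vars U] with an equation are acyclic; the correction
    lives there and leaves the value at [vars U] intact. *)
Lemma inv_prod_lift U :
    (forall v, (forall i, i \in U -> v i = 0) -> forall k, (f k).@[v] = 0) ->
  exists b : cochain, [/\ valid gen b, indeg #|U| b,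
    forall s, s :\: vars U \subset eqs -> diff b s = 0
    & b (vars U) = (\prod_(i in U) 'X_i : A)%:F^-1].
Proof.
move=> Uf; set y := _^-1.
pose b0 : cochain := [ffun s => if s == vars U then y else 0].
have vb0 : valid gen b0.
  move=> s; rewrite ffunE; case: eqP => [->|_]; last exact: loc0.
  rewrite gprod_vars; exists 1%N, 1; rewrite expr1 mulVf ?tofrac1 //.
  rewrite tofrac_eq0; apply/prodf_neq0 => i _.
  by rewrite -msize_poly_eq0 msizeX.
have hb0 : indeg #|U| b0.
  by move=> s; rewrite ffunE; case: (s =P vars U) => [->|//]; rewrite card_vars eqxx.
have [|||||||b [vb hb bB be]] := @column_acyclic _ _ gen gen_neq0 (vars U)
  (fun s => s \subset eqs) (fun s => [exists k, inl k \in s]) _ _ _ (diff b0) #|U|.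
- by move=> s s'; apply: fintype.subset_trans.
- by move=> s s' /fintype.subsetP ss' /existsP[k ks]; apply/existsP; exists k; apply: ss'.
- move=> s _ /existsP[k ks]; apply: gen_rad => v vU; exists (inl k) => //.
  by apply: Uf => i iU; rewrite -[LHS](mevalXU v i); apply: (vU (inr i)); rewrite inE.
- exact: valid_diff.
- exact: indeg_diff.
- by move=> s _; rewrite diff_diff ffunE.
- move=> s /fintype.subsetP sD sB; rewrite ffunE big1 // => i si; rewrite ffunE ifF ?mulr0 //.
  apply: contraNF sB => /eqP sU; have iU : i \notin vars U by rewrite -sU !inE eqxx.
  have := sD i; rewrite inE iU si => /(_ isT); rewrite inE.
  by case: i si {sU} iU => // k ks kU _; apply/existsP; exists k; rewrite inE kU.
exists (b0 - b); split.
- by apply: valid_add => //; apply: valid_opp.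
- exact: indegB.
- by move=> s sU; rewrite diffB ffunE [X in _ + X]ffunE be ?subrr.
- rewrite !ffunE eqxx bB ?subr0 //; apply/existsPn => k.
  by rewrite finset.setDv inE.
Qed.

(** With fewer than #|U| equations, the lifted class vanishes on sets of equations alone, and
    columns along [eqs] containing a variable of [U] are acyclic. The class would then be a
    coboundary. *)
Theorem coordinate_subspace_equations U :
    (forall v, (forall k, (f k).@[v] = 0) <-> (forall i, i \in U -> v i = 0)) ->
  (#|U| <= r)%N.
Proof.
move=> Uf; rewrite leqNgt; apply/negP => rU.
have [|e [ve he de eU]] := @inv_prod_lift U; first by move=> v /Uf.
case: #|U| rU he => // p rp he.
have [|||||||b [vb hb bB be]] := @column_acyclic _ _ gen gen_neq0 eqs
  (fun s => s \subset vars U) (fun s => [exists i, inr i \in s]) _ _ _ e p.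
- by move=> s s'; apply: fintype.subset_trans.
- by move=> s s' /fintype.subsetP ss' /existsP[k ks]; apply/existsP; exists k; apply: ss'.
- move=> s /fintype.subsetP sU /existsP[i si]; apply: gen_rad => v vU; exists (inr i) => //.
  rewrite /= mevalXU; apply: (Uf v).1; last by have := sU _ si; rewrite inE.
  by move=> k; apply: (vU (inl k)); rewrite inE.
- by [].
- by [].
- move=> s /fintype.subsetP sU; apply: de; apply/fintype.subsetP => j; rewrite !inE => /andP[jU js].
  by case: j jU js => // i iU si; have := sU (inr i); rewrite !inE (negPf iU) => ->.
- move=> s _ sB; apply: he; rewrite neq_ltn; apply/orP; left.
  apply: leq_ltn_trans rp; apply: card_sub_eqs => i; apply: contra sB => si.
  by apply/existsP; exists i; rewrite !inE.
have := diff_vars_neq_inv U vb; rewrite be ?eU ?eqxx //.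
by apply/fintype.subsetP => j; rewrite !inE; case: j.
Qed.


(** Here [X] lists the free coordinates of a subspace. Sets avoiding [X] use only the variables that
    cut it out, and give the part of the complex with support in it. *)
Definition avoids X : pred {set J} := fun s => [forall i in X, inr i \notin s].

Lemma avoidsP X s : reflect (forall i, i \in X -> inr i \notin s) (avoids X s).
Proof. exact: forall_inP. Qed.

Lemma avoids_sub X s s' : s' \subset s -> avoids X s -> avoids X s'.
Proof.
move=> /fintype.subsetP ss' /avoidsP sX; apply/avoidsP => i /sX.
by apply: contra; apply: ss'.
Qed.

Lemma avoids_eqs X s : avoids X (s :\: eqs) = avoids X s.
Proof. by apply: eq_forallb => i; rewrite !inE. Qed.

Lemma avoids_vars X s : avoids X (s :\: vars (~: X)) = avoids X s.
Proof. by apply: eq_forallb => i; rewrite !inE; case: (i \in X). Qed.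

(** Columns along the variables outside [X] are acyclic as soon as they contain an equation; without
    one, there are too few variables to reach degree [p.+1]. *)
Lemma cocycle_half X (e : cochain) p :
    valid gen e -> indeg p.+1 e -> diff e = 0 -> (#|~: X| <= p)%N ->
    (forall v, (forall i, i \notin X -> v i = 0) -> forall k, (f k).@[v] = 0) ->
  exists b : cochain, [/\ valid gen b, indeg p b
    & forall s, avoids X s -> diff b s = e s].
Proof.
move=> ve he de Xp Xf.
have [|||||||b [vb hb bB be]] := @column_acyclic _ _ gen gen_neq0 (vars (~: X))
  (avoids X) (fun s => [exists k, inl k \in s]) _ _ _ e p.
- by move=> s s'; apply: avoids_sub.
- by move=> s s' /fintype.subsetP ss' /existsP[k ks]; apply/existsP; exists k; apply: ss'.
- move=> s _ /existsP[k ks]; apply: gen_rad => v vU; exists (inl k) => //.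
  by apply: Xf => i iX; rewrite -[LHS](mevalXU v i); apply: (vU (inr i)); rewrite !inE.
- by [].
- by [].
- by move=> s _; rewrite de ffunE.
- move=> s; rewrite avoids_vars => /avoidsP sX sB; apply: he.
  rewrite neq_ltn ltnS; apply/orP; left; apply: leq_trans Xp.
  rewrite -card_vars; apply: subset_leq_card; apply/fintype.subsetP => -[k|i] si.
    by case/existsP: sB; exists k; rewrite !inE.
  by rewrite !inE; apply: contraL si => /sX.
by exists b; split=> // s sX; apply: be; rewrite avoids_vars.
Qed.

Theorem two_coordinate_subspaces_equations X Z :
    X != finset.set0 -> Z != finset.set0 -> (forall i, i \in X -> i \notin Z) ->
    (forall v, (forall k, (f k).@[v] = 0) <->
       (forall i, i \notin X -> v i = 0) \/ (forall i, i \notin Z -> v i = 0)) ->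
  (N <= r.+1)%N.
Proof.
move=> X0 Z0 dXZ XZf; rewrite leqNgt; apply/negP => rN.
have cardC (Y : {set 'I_N}) : Y != finset.set0 -> (#|~: Y| < N)%N.
  rewrite -card_gt0 => Y0.
  have YN : (#|Y| + #|~: Y| = N)%N by rewrite finset.cardsC card_ord.
  by rewrite -[X in (_ < X)%N]YN -[X in (X < _)%N]add0n ltn_add2r.
(* The class supported at the origin, which lies on both subspaces. *)
have [|e [ve he de eT]] := @inv_prod_lift finset.setT.
  by move=> v v0; apply/XZf; left=> i _; apply: v0; rewrite inE.
have {}de : diff e = 0.
  apply/ffunP => s; rewrite [RHS]ffunE; apply: de.
  by apply/fintype.subsetP => -[k|i]; rewrite !inE.
move: he; rewrite cardsT card_ord.
move=> he; have [p Np] : exists p, N = p.+2.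
  by exists N.-2; rewrite -[in LHS](subnKC rN) -[in RHS](subnKC rN).
have rp : (r <= p)%N by rewrite -2!ltnS -Np.
have {}he : indeg p.+2 e by rewrite -Np.
have [||a [va ha ea]] := @cocycle_half X e p.+1 ve he de.
- by rewrite -ltnS -Np cardC.
- by move=> v v0; apply/XZf; left.
have [||b [vb hb eb]] := @cocycle_half Z e p.+1 ve he de.
- by rewrite -ltnS -Np cardC.
- by move=> v v0; apply/XZf; right.
(* On sets avoiding both [X] and [Z], [a - b] is a cocycle of degree N - 1. It is a coboundary: the
   variables left vanish on the whole zero set, and N - 2 equations alone do not reach that
   degree. *)
have [|||||||d [vd hd dB ed]] := @column_acyclic _ _ gen gen_neq0 eqs
  (fun s => avoids X s && avoids Z s) (fun s => [exists i, inr i \in s]) _ _ _ (a - b) p.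
- by move=> s s' ss' /andP[sX sZ]; rewrite !(avoids_sub ss').
- by move=> s s' /fintype.subsetP ss' /existsP[k ks]; apply/existsP; exists k; apply: ss'.
- move=> s /andP[/avoidsP sX /avoidsP sZ] /existsP[i si]; apply: gen_rad => v vU.
  exists (inr i) => //; rewrite /= mevalXU.
  have [|v0|v0] := (XZf v).1; first by move=> k; apply: (vU (inl k)); rewrite inE.
    by apply: v0; apply: contraL si => /sX.
  by apply: v0; apply: contraL si => /sZ.
- by apply: valid_add => //; apply: valid_opp.
- exact: indegB.
- move=> s; rewrite !avoids_eqs => /andP[sX sZ].
  by rewrite diffB ffunE [X in _ + X]ffunE ea ?eb ?subrr.
- move=> s _ sB; apply: (indegB ha hb); rewrite neq_ltn ltnS; apply/orP; left.
  apply: leq_trans rp.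
  apply: card_sub_eqs => i; apply: contra sB => si.
  by apply/existsP; exists i; rewrite !inE.
(* Corrected by [d], the two primitives agree on the overlap and glue. *)
pose w : cochain := [ffun s : {set J} =>
  if avoids X s then (a - diff d) s else if avoids Z s then b s else 0].
have wX s : avoids X s -> diff w s = e s.
  move=> sX; rewrite -ea // -[diff a]subr0 -(diff_diff d) -diffB.
  by apply: eq_diff => s' ss'; rewrite [LHS]ffunE (avoids_sub ss' sX).
have wZ s : avoids Z s -> diff w s = e s.
  move=> sZ; rewrite -eb //; apply: eq_diff => s' ss'.
  have sZ' := avoids_sub ss' sZ; rewrite [LHS]ffunE sZ'; case: ifP => // sX'.
  rewrite ffunE [X in _ + X]ffunE ed ?avoids_eqs ?sX' //.
  by rewrite ffunE [X in _ - (_ + X)]ffunE opprB addrC subrK.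
have vw : valid gen w.
  move=> s; rewrite ffunE; case: ifP => _; last by case: ifP => _; [apply: vb | apply: loc0].
  by apply: valid_add => //; apply: valid_opp; apply: valid_diff.
have hw : indeg p.+1 w.
  move=> s sp; rewrite ffunE; case: ifP => _; last by case: ifP => _ //; apply: hb.
  by apply: indegB sp => //; apply: indeg_diff.
(* What remains of [e] lives on sets meeting both [X] and [Z]. There a product of a variable from
   each vanishes on the union of the subspaces, so columns along [eqs] are acyclic. *)
have [|||||||q [vq hq qB qe]] := @column_acyclic _ _ gen gen_neq0 eqs
  predT (fun s => ~~ avoids X s && ~~ avoids Z s) _ _ _ (e - diff w) p.+1.
- by [].
- by move=> s s' ss' /andP[sX sZ]; rewrite !(contra (avoids_sub ss')).
- move=> s _ /andP[/forall_inPn[i iX /negPn si] /forall_inPn[j jZ /negPn sj]].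
  apply: gen_rad => v vU.
  have [|v0|v0] := (XZf v).1; first by move=> k; apply: (vU (inl k)); rewrite inE.
    by exists (inr j); rewrite //= mevalXU v0 //; apply: contraL jZ => /dXZ.
  by exists (inr i); rewrite //= mevalXU v0 // dXZ.
- by apply: valid_add => //; apply: valid_opp; apply: valid_diff.
- by apply: indegB => //; apply: indeg_diff.
- by move=> s _; rewrite diffB de diff_diff subr0 ffunE.
- move=> s _; rewrite !avoids_eqs negb_and !negbK => /orP[/wX|/wZ] ws;
    by rewrite ffunE [X in _ + X]ffunE ws subrr.
have := @diff_vars_neq_inv (w + q) finset.setT (valid_add vw vq).
by rewrite diffD ffunE qe // [X in _ + X]ffunE [X in _ + (_ + X)]ffunE addrC subrK eT eqxx.
Qed.

End ZeroSet.

Section ZeroSetSeq.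
Variables (K : closedFieldType) (N : nat) (fs : seq {mpoly K[N]}).
Hypothesis uncountK : ~ countable [set: K].

(** Localizations inside the fraction field need nonzero generators; discarding zero equations keeps
    the zero set. *)
Let nz := [seq f <- fs | f != 0].
Let nz_fun (k : 'I_(size nz)) := nz`_k.

Let nz_neq0 k : nz_fun k != 0.
Proof. by have := mem_nth 0 (ltn_ord k); rewrite mem_filter => /andP[]. Qed.

Let nz_zeros v :
  (forall k, (nz_fun k).@[v] = 0) <-> (forall f, f \in fs -> f.@[v] = 0).
Proof.
split=> [nz0 f ffs|fs0 k]; last first.
  by apply: fs0; have := mem_nth 0 (ltn_ord k); rewrite mem_filter => /andP[].
have [->|f0] := eqVneq f 0; first by rewrite meval0.
have fnz : f \in nz by rewrite mem_filter f0.
have := nz0 (Ordinal (etrans (index_mem f nz) fnz)).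
by rewrite /nz_fun /= nth_index.
Qed.

Lemma zeros_coordinate_subspace (U : {set 'I_N}) :
    (forall v, (forall f, f \in fs -> f.@[v] = 0) <->
               (forall i, i \in U -> v i = 0)) ->
  (#|U| <= size fs)%N.
Proof.
move=> Uf; apply: leq_trans (_ : size nz <= _)%N; last by rewrite size_filter count_size.
by apply: (coordinate_subspace_equations uncountK nz_neq0) => v; rewrite nz_zeros.
Qed.

Lemma zeros_two_coordinate_subspaces (X Z : {set 'I_N}) :
    X != finset.set0 -> Z != finset.set0 -> (forall i, i \in X -> i \notin Z) ->
    (forall v, (forall f, f \in fs -> f.@[v] = 0) <->
       (forall i, i \notin X -> v i = 0) \/ (forall i, i \notin Z -> v i = 0)) ->
  (N <= (size fs).+1)%N.
Proof.
move=> X0 Z0 XZ XZf; apply: leq_trans (_ : (size nz).+1 <= _)%N; last first.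
  by rewrite ltnS size_filter count_size.
apply: (two_coordinate_subspaces_equations uncountK nz_neq0 X0 Z0 XZ) => v.
by rewrite nz_zeros.
Qed.

End ZeroSetSeq.

(** * Invariants of tuples of 2x2 matrices *)

From mathcomp Require lebesgue_measure.

(** The unit interval has Lebesgue measure 1, a countable set has measure 0. *)
Lemma uncountable_real (R : realType) : ~ countable [set: R].
Proof.
move=> Rcount.
have := lebesgue_measure.lebesgue_measure_itv `[0%R : R, 1%R].
rewrite /= constructive_ereal.lte_fin ltr01 lebesgue_measure.countable_lebesgue_measure0.
  by rewrite -constructive_ereal.EFinD oppr0 addr0 => -[/esym/eqP]; rewrite oner_eq0.
by apply: sub_countable Rcount; apply: subset_card_le; apply: subsetT.
Qed.

Lemma uncountable_complex (R : realType) : ~ countable [set: R[i]].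
Proof.
move=> /countable_injP[f finj]; apply: (@uncountable_real R).
apply/countable_injP; exists (fun x => f x%:C%C) => x y _ _ /finj.
by rewrite !inE => /(_ I I) [].
Qed.

Section Slice.
Variables (R : realType) (n : nat).
Local Notation K := R[i].
Local Notation V := (Mat22n R n).
Local Notation dim := #|{: 'I_n * ('I_2 * 'I_2)}|.

Definition tuple_of (M : 'I_n -> 'I_2 -> 'I_2 -> K) : V := [ffun k => \matrix_(a, b) M k a b].

Definition subst_entries l (p : {mpoly K[dim]}) (M : 'I_n -> 'I_2 -> 'I_2 -> {mpoly K[l]}) :=
  p \mPo [tuple M (enum_val j).1 (enum_val j).2.1 (enum_val j).2.2 | j < dim].

Lemma subst_entriesE l p M (u : 'I_l -> K) :
  (subst_entries p M).@[u] = p.@[coords (tuple_of (fun k a b => (M k a b).@[u]))].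
Proof.
rewrite comp_mpoly_meval; apply: meval_eq => j.
by rewrite tnth_mktuple /coords ffunE mxE.
Qed.

Lemma poly_fun_cst (c : K) : polynomial_functions (fun _ : V => c).
Proof. by exists c%:MP => v; rewrite mevalC. Qed.

Lemma poly_fun_coord k a b : polynomial_functions (fun v : V => v k a b).
Proof.
by exists 'X_(enum_rank (k, (a, b))) => v; rewrite mevalXU /coords enum_rankK.
Qed.

Lemma poly_funM (f g : V -> K) : polynomial_functions f -> polynomial_functions g ->
  polynomial_functions (fun v => f v * g v).
Proof. by move=> [p pf] [q qg]; exists (p * q) => v; rewrite mevalM pf qg. Qed.

Lemma poly_fun_sum (J : finType) (f : J -> V -> K) :
  (forall j, polynomial_functions (f j)) -> polynomial_functions (fun v => \sum_j f j v).
Proof.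
move=> /choice[p pf]; exists (\sum_j p j) => v.
by rewrite raddf_sum; apply: eq_bigr => j _; rewrite pf.
Qed.

Definition poly_mx (F : V -> 'M[K]_2) := forall a b, polynomial_functions (fun v => F v a b).

Lemma poly_mxM F G : poly_mx F -> poly_mx G -> poly_mx (fun v => F v *m G v).
Proof.
move=> pF pG a b; under eq_fun do rewrite mxE.
by apply: poly_fun_sum => c; apply: poly_funM.
Qed.

Lemma poly_mx_cst C : poly_mx (fun=> C).
Proof. by move=> a b; apply: poly_fun_cst. Qed.

Lemma poly_mx_trace F : poly_mx F -> polynomial_functions (fun v => \tr (F v)).
Proof. by move=> pF; apply: poly_fun_sum => a. Qed.

(** The standard symplectic matrix. *)
Definition Jmx : 'M[K]_2 := \matrix_(a, b) ((a < b)%:R - (b < a)%:R).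

(* The adjugate of a 2x2 matrix, written so that antimultiplicativity is clear. *)
Fact adj2_key : unit. Proof. by []. Qed.
Definition adj2 : 'M[K]_2 -> 'M[K]_2 :=
  locked_with adj2_key (fun A => Jmx *m A^T *m Jmx^T).

Lemma poly_mx_coord k : poly_mx (fun v => v k).
Proof. by move=> a b; apply: poly_fun_coord. Qed.

Lemma poly_mx_adj2 k : poly_mx (fun v => adj2 (v k)).
Proof.
rewrite [adj2]unlock.
apply: poly_mxM (poly_mx_cst _); apply: poly_mxM (poly_mx_cst _) _ => a b.
by under eq_fun do rewrite mxE; apply: poly_fun_coord.
Qed.

Lemma ord2P (a : 'I_2) : a = 0 \/ a = 1.
Proof. by case: a => [[|[|//]] ?]; [left | right]; apply: val_inj. Qed.

Lemma sum_ord2 (F : 'I_2 -> K) : \sum_a F a = F 0 + F 1.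
Proof. by rewrite !big_ord_recl big_ord0 addr0; congr (_ + F _); apply: val_inj. Qed.

Lemma det_mx22 (A : 'M[K]_2) : \det A = A 0 0 * A 1 1 - A 0 1 * A 1 0.
Proof.
rewrite (expand_det_row _ 0) sum_ord2 /cofactor !det_mx11 !mxE /=.
have -> : lift 0 0 = 1 :> 'I_2 by apply: val_inj.
have -> : lift 1 0 = 0 :> 'I_2 by apply: val_inj.
by rewrite expr0 expr1; ring.
Qed.

Lemma mulmx22 (A B : 'M[K]_2) a b : (A *m B) a b = A a 0 * B 0 b + A a 1 * B 1 b.
Proof. by rewrite mxE sum_ord2. Qed.

Lemma adj2E A : (adj2 A 0 0 = A 1 1) * (adj2 A 0 1 = - A 0 1) *
  (adj2 A 1 0 = - A 1 0) * (adj2 A 1 1 = A 0 0).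
Proof. by rewrite [adj2]unlock !mulmx22 !mxE /=; do !split; ring. Qed.

Lemma mulmx_adj2 A : A *m adj2 A = (\det A)%:M.
Proof.
rewrite det_mx22; apply/matrixP => a b; rewrite mulmx22 [RHS]mxE.
by have [->|->] := ord2P a; have [->|->] := ord2P b; rewrite !adj2E /=; ring.
Qed.

Lemma adj2_invmx A : \det A = 1 -> adj2 A = invmx A.
Proof.
move=> A1; have := mulmx_adj2 A; rewrite A1 => /(congr1 (mulmx (invmx A))).
by rewrite mulmxA mulVmx ?unitmxE ?A1 ?unitr1 // mul1mx mulmx1.
Qed.

Lemma adj2M A B : adj2 (A *m B) = adj2 B *m adj2 A.
Proof.
apply/matrixP => a b; rewrite [RHS]mulmx22.
by have [->|->] := ord2P a; have [->|->] := ord2P b; rewrite !adj2E mulmx22; ring.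
Qed.

Lemma tr_mulmx22 (A B : 'M[K]_2) :
  \tr (A *m B) = A 0 0 * B 0 0 + A 0 1 * B 1 0 + A 1 0 * B 0 1 + A 1 1 * B 1 1.
Proof. by rewrite /mxtrace sum_ord2 !mulmx22; ring. Qed.

(** This is the polar form of the determinant, equal to [2 * \det A] when [B = A]. *)
Lemma tr_adj2 (A B : 'M[K]_2) : \tr (A *m adj2 B) =
  A 0 0 * B 1 1 + A 1 1 * B 0 0 - A 0 1 * B 1 0 - A 1 0 * B 0 1.
Proof. by rewrite tr_mulmx22 !adj2E; ring. Qed.

Lemma tr_adj2_4 (A B C D : 'M[K]_2) : A 1 0 = 0 -> A 0 1 = 0 -> A 1 1 = 0 ->
    C 0 0 = 0 -> C 0 1 = 0 -> C 1 0 = 0 ->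
  \tr (A *m adj2 B *m C *m adj2 D) = A 0 0 * C 1 1 * B 0 1 * D 1 0.
Proof.
move=> A1 A2 A3 C1 C2 C3.
rewrite -mulmxA tr_mulmx22 !mulmx22 !adj2E A1 A2 A3 C1 C2 C3; ring.
Qed.

(** The factor [h] cancels in the middle, so such products are merely conjugated and their traces
    are invariant. *)
Lemma act_adj2 (g h : 'M[K]_2) (v : V) i j : SL2 g -> SL2 h ->
  act (invmx g, invmx h) v i *m adj2 (act (invmx g, invmx h) v j)
  = invmx g *m (v i *m adj2 (v j)) *m g.
Proof.
move=> g1 h1; rewrite !ffunE /= invmxK.
have g1' : \det (invmx g) = 1 by rewrite det_inv g1 invr1.
rewrite !adj2M (adj2_invmx h1) (adj2_invmx g1') invmxK -!mulmxA.
by rewrite [h *m _]mulmxA mulmxV ?mul1mx // unitmxE h1 unitr1.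
Qed.

Lemma invariant_trace2 i j : invariants (fun v : V => \tr (v i *m adj2 (v j))).
Proof.
split.
  by apply: poly_mx_trace; apply: poly_mxM (poly_mx_coord _) (poly_mx_adj2 _).
move=> [g h] [/= g1 h1]; apply/funext => v; rewrite /act_fun /= act_adj2 //.
by rewrite mxtrace_mulC mulmxA mulmxV ?mul1mx // unitmxE g1 unitr1.
Qed.

Lemma invariant_trace4 i j k l : invariants
  (fun v : V => \tr (v i *m adj2 (v j) *m v k *m adj2 (v l))).
Proof.
split.
  apply: poly_mx_trace; apply: poly_mxM (poly_mx_adj2 _).
  apply: poly_mxM (poly_mx_coord _).
  exact: poly_mxM (poly_mx_coord _) (poly_mx_adj2 _).
move=> [g h] [/= g1 h1]; apply/funext => v; rewrite /act_fun /=.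
have gu : g \in unitmx by rewrite unitmxE g1 unitr1.
rewrite -mulmxA (act_adj2 _ i j g1 h1) (act_adj2 _ k l g1 h1).
move: (v i *m _) => P; rewrite -[in RHS](mulmxA P); move: (v k *m _) => P'.
by rewrite mulmxA mxtrace_mulC !mulmxA mulmxV // mul1mx -!mulmxA mulKVmx.
Qed.

(* Conjugating by diag(u, 1/u) multiplies the upper right entries by [u ^+ 2]
   and [u] is arbitrary, so the invariant is constant along this line. *)
Lemma invariant_upper_triangular (f : V -> K) (v w : V) : invariants f ->
    (forall k, v k 1 0 = 0) -> (forall k, w k 1 0 = 0) ->
    (forall k a, v k a a = w k a a) ->
  f v = f w.
Proof.
move=> [[p fp] finv].
suff diag (x : V) : (forall k, x k 1 0 = 0) ->
    f x = f (tuple_of (fun k a b => if a == b then x k a a else 0)).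
  move=> v0 w0 vw; rewrite (diag v v0) (diag w w0); congr f; apply/ffunP => k; apply/matrixP => a b.
  by rewrite !ffunE !mxE vw.
move=> x0.
(* A line of tuples, from the diagonal part of [x] at parameter 0 to [x] itself at parameter 1. *)
pose M k (a b : 'I_2) : {mpoly K[1]} :=
  if a == b then (x k a a)%:MP else if a == 0 then (x k 0 1)%:MP * 'X_0 else 0.
pose y u : V := tuple_of (fun k a b => (M k a b).@[u]).
have yf u : f (y u) = (subst_entries p M).@[u] by rewrite fp subst_entriesE.
have y1 : y (fun=> 1) = x.
  apply/ffunP => k; apply/matrixP => a b; rewrite ffunE mxE /M.
  have [->|->] := ord2P a; have [->|->] := ord2P b;
    by rewrite /= ?mevalM ?mevalC ?mevalXU ?mulr1 ?meval0 ?x0.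
have y0 : y (fun=> 0) = tuple_of (fun k a b => if a == b then x k a a else 0).
  apply/ffunP => k; apply/matrixP => a b; rewrite !ffunE !mxE /M.
  have [->|->] := ord2P a; have [->|->] := ord2P b;
    by rewrite /= ?mevalM ?mevalC ?mevalXU ?mulr0 ?meval0.
have yu u : u 0 != 0 -> f (y u) = f x.
  move=> u0; pose c := sqrtC (u 0).
  have c0 : c != 0 by rewrite sqrtC_eq0.
  pose g : 'M[K]_2 := \matrix_(a, b) if a == b then if a == 0 then c^-1 else c else 0.
  have g1 : SL2 g by rewrite /SL2 /= det_mx22 !mxE /= mulr0 subr0 mulVf.
  have gg : invmx g = \matrix_(a, b) if a == b then if a == 0 then c else c^-1 else 0.
    rewrite -adj2_invmx //; apply/matrixP => a b.
    have [->|->] := ord2P a; have [->|->] := ord2P b;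
      by rewrite adj2E !mxE /= ?oppr0.
  have := finv (g, g) (conj g1 g1) => /(congr1 (fun F => F x)) <-.
  rewrite /act_fun; congr f; apply/ffunP => k; rewrite !ffunE /= invmxK gg.
  apply/matrixP => a b; rewrite [RHS]mulmx22 !mulmx22 !mxE /M.
  have cc : u 0 = c * c by rewrite -expr2 sqrtCK.
  have [->|->] := ord2P a; have [->|->] := ord2P b;
    rewrite /= ?mevalM ?mevalC ?mevalXU ?meval0 ?x0 ?cc; try by field.
(* The factor ['X_0] absorbs the parameter 0, not reached by the torus. Then [h] vanishes everywhere
   and is zero, which extends the equality to that parameter. *)
pose h : {mpoly K[1]} := 'X_0 * (subst_entries p M - (f x)%:MP).
have h0 : h = 0.
  have idI : is_ideal [set q : {mpoly K[1]} | q = 0].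
    by split=> //= [q1 q2 -> ->|a q ->]; rewrite ?addr0 ?mulr0.
  have [|D /eqP] := nullstellensatz (@uncountable_complex R) idI (h := h).
    move=> u _; rewrite /h mevalM mevalXU mevalB mevalC -yf.
    by have [->|/yu->] := eqVneq (u 0) 0; rewrite ?mul0r ?subrr ?mulr0.
  by rewrite expf_eq0 => /andP[_ /eqP].
have : subst_entries p M = (f x)%:MP.
  apply/eqP; rewrite -subr_eq0; move/eqP: h0; rewrite mulf_eq0 => /orP[|//].
  by rewrite -msize_poly_eq0 msizeX.
by move=> e; rewrite -y0 yf e mevalC.
Qed.

End Slice.

(** * The slice *)

Section SliceEquations.
Variables (R : realType) (n : nat) (n_gt2 : (2 < n)%N).
Local Notation K := R[i].
Local Notation V := (Mat22n R n).

Let i0 : 'I_n := Ordinal (ltnW (ltnW n_gt2)).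
Let i1 : 'I_n := Ordinal (ltnW n_gt2).
Let i2 : 'I_n := Ordinal n_gt2.

(* Among the parameters attached to the k-th matrix, [x 3 k] moves the base point
   and the other [x c k] are the entries of a displacement. *)
Definition base_entry (L : pzRingType) (x : 'I_5 -> 'I_n -> L) (k : 'I_n) (a b : 'I_2) : L :=
  if a == 0 then if b == 0 then (k == i0)%:R else (k == i2)%:R
  else if b == 0 then x 3 k else (k == i1)%:R.

Definition moved_entry (L : pzRingType) (x : 'I_5 -> 'I_n -> L) (k : 'I_n) (a b : 'I_2) : L :=
  base_entry x k a b +
    (if a == 0 then if b == 0 then x 0 k else x 2 k
     else if b == 0 then x 4 k else x 1 k).

Definition base_pt (x : 'I_5 -> 'I_n -> K) : V := tuple_of (base_entry x).
Definition moved_pt (x : 'I_5 -> 'I_n -> K) : V := tuple_of (moved_entry x).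

Lemma base_ptE x k a b : base_pt x k a b = base_entry x k a b.
Proof. by rewrite ffunE mxE. Qed.

Lemma moved_ptE x k a b : moved_pt x k a b = moved_entry x k a b.
Proof. by rewrite ffunE mxE. Qed.

(* Setting these parameters to zero normalizes the base point and makes the
   displacements transverse to its orbit. *)
Definition frozen : seq ('I_5 * 'I_n) :=
  [:: (0, i0); (2, i0); (2, i1); (2, i2); (3, i0); (3, i1); (4, i0); (4, i1)].

(** Traces of two matrices, one of index [i0] or [i1], remove the diagonal displacements. Traces of
    four then give [x 4 = 0] and [x 2 k * x 3 j = 0] for all [k] and [j], so one of these two
    families vanishes. *)
Lemma same_invariants_slice (x : 'I_5 -> 'I_n -> K) :
    (forall ck, ck \in frozen -> x ck.1 ck.2 = 0) ->
    (forall f, invariants f -> f (base_pt x) = f (moved_pt x)) ->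
  (forall c k, c != 2 -> x c k = 0) \/ (forall c k, c != 3 -> x c k = 0).
Proof.
move=> x0 xinv.
pose e (i : 'I_n) k : K := (k == i)%:R.
have e1 i : e i i = 1 by rewrite /e eqxx.
have e0 i k : k != i -> e i k = 0 by rewrite /e => /negPf ->.
have x00 : x 0 i0 = 0 by apply: (x0 (0, i0)); rewrite !inE eqxx.
have x20 : x 2 i0 = 0 by apply: (x0 (2, i0)); rewrite !inE eqxx ?orbT.
have x21 : x 2 i1 = 0 by apply: (x0 (2, i1)); rewrite !inE eqxx ?orbT.
have x22 : x 2 i2 = 0 by apply: (x0 (2, i2)); rewrite !inE eqxx ?orbT.
have x30 : x 3 i0 = 0 by apply: (x0 (3, i0)); rewrite !inE eqxx ?orbT.
have x31 : x 3 i1 = 0 by apply: (x0 (3, i1)); rewrite !inE eqxx ?orbT.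
have x40 : x 4 i0 = 0 by apply: (x0 (4, i0)); rewrite !inE eqxx ?orbT.
have x41 : x 4 i1 = 0 by apply: (x0 (4, i1)); rewrite !inE eqxx ?orbT.
have q i j : (e i0 i + x 0 i) * (e i1 j + x 1 j) + (e i1 i + x 1 i) * (e i0 j + x 0 j)
    - (e i2 i + x 2 i) * (x 3 j + x 4 j) - (x 3 i + x 4 i) * (e i2 j + x 2 j)
    - (e i0 i * e i1 j + e i1 i * e i0 j - e i2 i * x 3 j - x 3 i * e i2 j) == 0.
  have := xinv _ (invariant_trace2 _ i j).
  by rewrite !tr_adj2 !base_ptE !moved_ptE => /esym/eqP; rewrite -subr_eq0.
have i10 : i1 != i0 by []. have i20 : i2 != i0 by []. have i21 : i2 != i1 by [].
have i01 : i0 != i1 by []. have i02 : i0 != i2 by []. have i12 : i1 != i2 by [].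
have x10 : x 1 i0 = 0.
  have := q i0 i0; rewrite e1 (e0 i1) // (e0 i2) // x00 x20 x30 x40.
  rewrite (_ : _ - _ = 2 * x 1 i0); last by ring.
  by rewrite mulf_eq0 pnatr_eq0 /= => /eqP.
have x11 : x 1 i1 = 0.
  have := q i0 i1; rewrite !e1 !(e0 i1 i0) // !(e0 i0 i1) // !e0 // x00 x20 x21 x30 x31 x40 x41 x10.
  by rewrite (_ : _ - _ = x 1 i1); [move/eqP | ring].
have x1 k : x 1 k = 0.
  have [->//|k0] := eqVneq k i0; have [->//|k1] := eqVneq k i1.
  have := q i0 k; rewrite e1 (e0 i1 i0) // (e0 i2 i0) // (e0 i0 k) // (e0 i1 k) // x00 x20 x30 x40 x10.
  by rewrite (_ : _ - _ = x 1 k); [move/eqP | ring].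
have x01 : x 0 i1 = 0.
  have := q i1 i1; rewrite e1 (e0 i0 i1) // (e0 i2 i1) // x21 x31 x41 !x1.
  rewrite (_ : _ - _ = 2 * x 0 i1); last by ring.
  by rewrite mulf_eq0 pnatr_eq0 /= => /eqP.
have x0k k : x 0 k = 0.
  have [->//|k0] := eqVneq k i0; have [->//|k1] := eqVneq k i1.
  have := q i1 k; rewrite e1 (e0 i0 i1) // (e0 i2 i1) // (e0 i0 k) // (e0 i1 k) // x01 x21 x31 x41 !x1.
  by rewrite (_ : _ - _ = x 0 k); [move/eqP | ring].
(* At both points the matrices [i0] and [i1] are now the diagonal matrix units, so the trace
   isolates the upper right entry of [i] times the lower left entry of [j]. *)
have t i j : e i2 i * x 3 j = (e i2 i + x 2 i) * (x 3 j + x 4 j).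
  have := xinv _ (invariant_trace4 _ i0 i i1 j).
  have simp := (e1, e0 i1 i0 i01, e0 i2 i0 i02, e0 i0 i1 i10, e0 i2 i1 i12).
  rewrite !tr_adj2_4 ?base_ptE ?moved_ptE /moved_entry /base_entry /= -/(e _ _) ?simp
    ?x00 ?x10 ?x20 ?x30 ?x40 ?x01 ?x11 ?x21 ?x31 ?x41 ?addr0 //.
  by rewrite -/(e i2 i) !mul1r.
have x4 k : x 4 k = 0.
  have := t i2 k; rewrite e1 x22 addr0 !mul1r => /eqP.
  by rewrite -subr_eq0 opprD addNKr oppr_eq0 => /eqP.
have ord5 (c : 'I_5) : [\/ c == 0, c == 1, c == 2 | (c == 3) || (c == 4)].
  by apply/or4P; case: c => [[|[|[|[|[|//]]]]] ?].
have [z0|/existsNP[j /eqP zj]] := pselect (forall k, x 3 k = 0).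
  left=> c k; case: (ord5 c) => [|||/orP[]] /eqP->; rewrite ?eqxx // => _.
right=> c k; case: (ord5 c) => [|||/orP[]] /eqP->; rewrite ?eqxx // => _.
apply/eqP; have /eqP := t k j; rewrite x4 addr0 eq_sym -subr_eq0 -mulrBl mulf_eq0.
by rewrite (negPf zj) orbF addrC addKr.
Qed.

Lemma slice_same_invariants (x : 'I_5 -> 'I_n -> K) (f : V -> K) :
    (forall c k, c != 2 -> x c k = 0) \/ (forall c k, c != 3 -> x c k = 0) ->
  invariants f -> f (base_pt x) = f (moved_pt x).
Proof.
move=> x0 finv; case: x0 => x0; last first.
  congr f; apply/ffunP => k; apply/matrixP => a b.
  rewrite base_ptE moved_ptE /moved_entry !x0 //.
  by have [->|->] := ord2P a; have [->|->] := ord2P b; rewrite /= addr0.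
apply: invariant_upper_triangular => // k.
- by rewrite base_ptE /base_entry /= x0.
- by rewrite moved_ptE /moved_entry /base_entry /= !x0 // addr0.
- move=> a; rewrite base_ptE moved_ptE /moved_entry /base_entry.
  by have [->|->] := ord2P a; rewrite /= x0 // addr0.
Qed.

(** * Equations of the slice in the 5n-dimensional parameter space *)

Local Notation N := #|{: 'I_5 * 'I_n}|.
Let par (u : 'I_N -> K) c k := u (enum_rank (c, k)).

Let indet c k : {mpoly K[N]} := 'X_(enum_rank (c, k)).

Let base_ptN u : tuple_of (fun k a b => (base_entry indet k a b).@[u]) = base_pt (par u).
Proof.
apply/ffunP => k; apply/matrixP => a b; rewrite base_ptE ffunE mxE /base_entry.
by have [->|->] := ord2P a; have [->|->] := ord2P b;
  rewrite /= ?mevalXU //; case: (_ == _); rewrite ?meval0 ?meval1.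
Qed.

Let moved_ptN u : tuple_of (fun k a b => (moved_entry indet k a b).@[u]) = moved_pt (par u).
Proof.
apply/ffunP => k; apply/matrixP => a b; rewrite moved_ptE ffunE mxE mevalD.
have := congr1 (fun v : V => v k a b) (base_ptN u).
rewrite /moved_entry base_ptE /= ffunE mxE => ->; congr (_ + _).
by have [->|->] := ord2P a; have [->|->] := ord2P b; rewrite /= mevalXU.
Qed.

Variables (m : nat) (P : 'I_m -> {mpoly K[#|{: 'I_n * ('I_2 * 'I_2)}|]}).
Hypothesis Psep : forall v w : V, (forall i, (P i).@[coords v] = (P i).@[coords w]) <->
  (forall f, invariants f -> f v = f w).

Let baseE i u : (subst_entries (P i) (base_entry indet)).@[u]
  = (P i).@[coords (base_pt (par u))].
Proof. by rewrite subst_entriesE base_ptN. Qed.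

Let movedE i u : (subst_entries (P i) (moved_entry indet)).@[u]
  = (P i).@[coords (moved_pt (par u))].
Proof. by rewrite subst_entriesE moved_ptN. Qed.

Let equations : seq {mpoly K[N]} :=
  codom (fun i => subst_entries (P i) (base_entry indet)
                  - subst_entries (P i) (moved_entry indet))
  ++ [seq 'X_(enum_rank ck) | ck <- frozen].

Let size_equations : size equations = (m + 8)%N.
Proof. by rewrite size_cat size_codom card_ord size_map. Qed.

Let cell (i : 'I_N) : 'I_5 * 'I_n := enum_val i.
Let free c b : {set 'I_N} := [set i | ((cell i).1 == c) && (b < (cell i).2)%N].

Let cellK ck : cell (enum_rank ck) = ck. Proof. exact: enum_rankK. Qed.
Let cell_enum i : enum_rank (cell i) = i. Proof. exact: enum_valK. Qed.

Let off_free (c : 'I_5) b u : (forall k, ((c, k) \in frozen) = (k <= b)%N) ->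
  (forall i, i \notin free c b -> u i = 0) <->
  (forall ck, ck \in frozen -> par u ck.1 ck.2 = 0) /\
  (forall d k, d != c -> par u d k = 0).
Proof.
move=> cb; split=> [u0|[uf uc] i].
  split=> [[d k] dk|d k dc]; apply: u0; rewrite inE cellK /= ?(negPf dc) //.
  by apply/negP => /andP[/eqP dc]; rewrite ltnNge -cb -dc dk.
rewrite inE -[i in u i]cell_enum negb_and; case: (cell i) => d k /=.
have [->|dc] := eqVneq d c; last by move=> _; apply: uc.
by rewrite -leqNgt -cb => /uf.
Qed.

(** Freezing fixes [x 2] at the first three indices and [x 3] at the first two, whence the
    thresholds 2 and 1: the subspaces have dimensions n - 3 and n - 2. *)
Let X := free 2 2.
Let Z := free 3 1.

Let offX u : (forall i, i \notin X -> u i = 0) <->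
  (forall ck, ck \in frozen -> par u ck.1 ck.2 = 0) /\
  (forall c k, c != 2 -> par u c k = 0).
Proof.
apply: off_free => k; rewrite !inE /= !xpair_eqE /= -!val_eqE /=.
by case: (val k) => [|[|[|]]].
Qed.

Let offZ u : (forall i, i \notin Z -> u i = 0) <->
  (forall ck, ck \in frozen -> par u ck.1 ck.2 = 0) /\
  (forall c k, c != 3 -> par u c k = 0).
Proof.
apply: off_free => k; rewrite !inE /= !xpair_eqE /= -!val_eqE /=.
by case: (val k) => [|[|]].
Qed.

Let zeros u : (forall f, f \in equations -> f.@[u] = 0) <->
  (forall i, i \notin X -> u i = 0) \/ (forall i, i \notin Z -> u i = 0).
Proof.
have -> : (forall f, f \in equations -> f.@[u] = 0) <->
   (forall i, (P i).@[coords (base_pt (par u))] = (P i).@[coords (moved_pt (par u))]) /\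
   (forall ck, ck \in frozen -> par u ck.1 ck.2 = 0).
  split=> [fu|[Pu uf] f].
    split=> [i|[c k] ck].
      apply: etrans (esym (baseE i u)) (etrans _ (movedE i u)).
      apply/eqP; rewrite -subr_eq0 -mevalB.
      by apply/eqP/fu; rewrite mem_cat codom_f.
    rewrite -[LHS](mevalXU u); apply: fu; rewrite mem_cat; apply/orP; right.
    by apply/mapP; exists (c, k).
  rewrite mem_cat => /orP[/codomP[]|/mapP[]].
    move=> i ->; rewrite mevalB; apply/eqP; rewrite subr_eq0; apply/eqP.
    exact: etrans (baseE i u) (etrans (Pu i) (esym (movedE i u))).
  by move=> [c k] /uf ck ->; rewrite mevalXU.
rewrite offX offZ; split=> [[/Psep Pu uf]|].
  by have [] := same_invariants_slice uf Pu; [left | right].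
by case=> -[uf u0]; split=> //; apply/Psep => f; apply: slice_same_invariants; [left | right].
Qed.

Lemma separating_polynomials_bound : (5 * n - 9 <= m)%N.
Proof.
have uncK := @uncountable_complex R.
have cardN : N = (5 * n)%N by rewrite card_prod !card_ord.
have Z0 : Z != finset.set0.
  by apply/set0Pn; exists (enum_rank (3, i2)); rewrite inE cellK.
(* For n > 3 both subspaces are nontrivial and 5n <= (m + 8) + 1. For n = 3 the zero set is a line
   of codimension 14, so 14 <= m + 8. *)
have [n3|n3] := ltnP 3 n.
  have X0 : X != finset.set0.
    by apply/set0Pn; exists (enum_rank (2, Ordinal n3)); rewrite inE cellK.
  have XZ i : i \in X -> i \notin Z by rewrite !inE => /andP[/eqP->].
  have := zeros_two_coordinate_subspaces uncK X0 Z0 XZ zeros.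
  rewrite size_equations cardN leq_subLR => h; apply: leq_trans h _.
  by rewrite -addnS addnC.
have Z1 : Z = finset.set1 (enum_rank (3 : 'I_5, i2)).
  apply/setP => i; rewrite !inE -[i in RHS]cell_enum (inj_eq enum_rank_inj).
  case: (cell i) => c k /=; rewrite xpair_eqE; congr (_ && _).
  have k2 : (k <= 2)%N by rewrite -ltnS (leq_trans (ltn_ord k)).
  by rewrite -val_eqE /= eqn_leq k2.
have : (#|~: Z| <= size equations)%N.
  apply: (zeros_coordinate_subspace uncK) => u; rewrite zeros.
  split=> [[u0 i _|u0 i]|u0]; last by right=> i iZ; apply: u0; rewrite inE.
    by apply: u0; rewrite inE negb_and -leqNgt -ltnS (leq_trans (ltn_ord _)) ?orbT.
  by rewrite inE; apply: u0.
rewrite size_equations cardsCs finset.setCK Z1 cards1.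
rewrite card_ord cardN !leq_subLR => h; apply: leq_trans h _.
by rewrite addnCA addnC.
Qed.

End SliceEquations.

(** * From separating sets to finite families of polynomials *)

Lemma not_card_le_II (T : Type) (S : set T) k :
  ~ (`I_k #<= S)%card -> exists2 m, (m < k)%N & (S #= `I_m)%card.
Proof.
move=> kS; have [[m Sm]|/infiniteP natS] := pselect (finite_set S).
  by exists m => //; rewrite ltnNge -card_le_II -(card_le_eqr Sm); apply/negP.
by exfalso; apply: kS; apply: card_le_trans natS; apply: subset_card_le.
Qed.

Lemma separating_polynomials (R : realType) n (S : set (Mat22n R n -> R[i])) m :
    separating S -> (S #= `I_m)%card ->
  exists P : 'I_m -> {mpoly R[i][#|{: 'I_n * ('I_2 * 'I_2)}|]},
    forall v w : Mat22n R n, (forall i, (P i).@[coords v] = (P i).@[coords w]) <->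
      (forall f, invariants f -> f v = f w).
Proof.
move=> [Sinv Ssep] /card_set_bijP[F [Flt Finj Fsurj]].
have /choice[P PF] (i : 'I_m) : exists p, exists2 s, S s & F s = i /\
    forall v, s v = p.@[coords v].
  have [s Ss Fs] := Fsurj i (ltn_ord i); have [[p ps] _] := Sinv s Ss.
  by exists p, s.
exists P => v w; rewrite -Ssep; split=> [Pvw s Ss|Svw i].
  have [s' Ss' [Fs' s'P]] := PF (Ordinal (Flt s Ss)).
  have -> : s = s' by apply: Finj; rewrite ?inE // Fs'.
  by rewrite !s'P Pvw.
by have [s Ss [_ sP]] := PF i; rewrite -!sP; apply: Svw.
Qed.

(** The invariant [2 * \det] of one matrix separates the zero tuple from the tuple of identity
    matrices. *)
Lemma separating_nonempty (R : realType) n (S : set (Mat22n R n -> R[i])) :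
  (0 < n)%N -> separating S -> S !=set0.
Proof.
move=> n0 [_ Ssep]; apply/set0P/negP => /eqP S0.
pose k := Ordinal n0.
have := (Ssep (tuple_of (fun _ _ _ => 0)) (tuple_of (fun _ a b => (a == b)%:R))).1.
rewrite S0 => /(_ (fun _ => False_ind _))/(_ _ (invariant_trace2 _ k k)).
rewrite !tr_adj2 !ffunE !mxE /= !mulr0 !mulr1 !subr0 addr0 => /eqP.
by rewrite eq_sym -mulr2n pnatr_eq0.
Qed.

Local Open Scope card_scope.

(* S may be infinite, so the bound is the cardinal comparison with
   {0, ..., 5n-10}; truncated subtraction is harmless since |S| >= 0. *)
Theorem theorem1p13 (R : realType) (n : nat) (hn : (1 <= n)%N)
    (S : set (Mat22n R n -> R[i])) (hS : separating S) :
  `I_(5 * n - 9) #<= S.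
Proof.
apply: contrapT => /not_card_le_II[m mn Sm].
case: m mn Sm => [|m] mn Sm.
  have [s Ss] := separating_nonempty hn hS.
  by move: Sm; rewrite II0 card_eq0 => /eqP S0; rewrite S0 in Ss.
(* For n at most 2 the bound is at most 1, already met by a nonempty set. *)
have n2 : (2 < n)%N by case: n hn {S hS Sm} mn => [|[|[|]]].
have [P PS] := separating_polynomials hS Sm.
by move: mn; rewrite ltnNge (separating_polynomials_bound n2 PS).
Qed.
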